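(* There exist numerical constants $C,c>0$ such that, for any $n\in\mathbb{N}$ and any pair of ellipsoids $\mathcal{E},\mathcal{B}\subset\mathbb{R}^n$, one has \[\log M(\mathcal{E},\mathcal{B})\le C\log \hat{M}(\mathcal{E}, c\,\mathcal{B}).\]
   Context: Ellipsoids are (origin-symmetric, nondegenerate) sets of the form $T(B_2^n)$ with $B_2^n$ the closed Euclidean unit ball and $T$ an invertible linear map. Logarithms are to base 2. For a set $K$ and a symmetric convex body $B$, the packing number $M(K,B)$ is the maximal number of translates $x_i+B$ with $x_i\in K$ whose interiors are pairwise disjoint (possibly $+\infty$). The convex separation number is \[\hat{M}(K,B):=\sup\{N:\ \exists\, x_1,\dots,x_N\in K \text{ such that } (x_j+\mathrm{int}\,B)\cap \mathrm{conv}\{x_i: i<j\}=\emptyset \text{ for all } j\},\] where $\mathrm{int}$ denotes interior and $\mathrm{conv}$ the convex hull (possibly $+\infty$). *)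

(* Defs.v *)
From HB Require Import structures.
From mathcomp Require Import all_boot all_order all_algebra.
From mathcomp Require Import all_classical all_reals all_analysis.
Set Implicit Arguments. Unset Strict Implicit. Unset Printing Implicit Defensive.
Import Order.TTheory GRing.Theory Num.Theory.
Import numFieldNormedType.Exports.
Local Open Scope classical_set_scope.
Local Open Scope ring_scope.

Section Defs.
Variables (R : realType) (n : nat).

Definition unit_ball2 : set 'rV[R]_n := [set x | \sum_(i < n) (x ord0 i) ^+ 2 <= 1].

Definition is_ellipsoid (E : set 'rV[R]_n) : Prop :=
  exists T : 'M[R]_n, T \in unitmx /\ E = (fun x => x *m T) @` unit_ball2.

Definition scale_set (c : R) (B : set 'rV[R]_n) : set 'rV[R]_n := (fun x => c *: x) @` B.

Definition translate_int (x : 'rV[R]_n) (B : set 'rV[R]_n) : set 'rV[R]_n :=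
  (fun y => x + y) @` (interior B).

Definition conv_fin (N : nat) (x : 'I_N -> 'rV[R]_n) : set 'rV[R]_n :=
  [set y | exists l : 'I_N -> R, (forall i, 0 <= l i) /\ \sum_(i < N) l i = 1 /\
                                 y = \sum_(i < N) l i *: x i].

Definition packing_ok (K B : set 'rV[R]_n) (N : nat) : Prop :=
  exists x : 'I_N -> 'rV[R]_n, (forall i, K (x i)) /\
    (forall i j, i != j -> translate_int (x i) B `&` translate_int (x j) B = set0).

Definition convsep_ok (K B : set 'rV[R]_n) (N : nat) : Prop :=
  exists x : 'I_N -> 'rV[R]_n, (forall i, K (x i)) /\
    (forall j : 'I_N,
       translate_int (x j) B `&`
         conv_fin (fun i : 'I_j => x (widen_ord (ltnW (ltn_ord j)) i)) = set0).

Definition packing_number (K B : set 'rV[R]_n) : \bar R :=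
  ereal_sup [set (N%:R)%:E | N in packing_ok K B].

Definition convsep_number (K B : set 'rV[R]_n) : \bar R :=
  ereal_sup [set (N%:R)%:E | N in convsep_ok K B].

End Defs.

Definition log2 {R : realType} (x : R) : R := ln x / ln 2.

Definition elog2 {R : realType} (x : \bar R) : \bar R :=
  match x with
  | r%:E => (log2 r)%:E
  | +oo%E => +oo%E
  | -oo%E => -oo%E
  end.

(* Main.v *)
Require Import Defs.
From HB Require Import structures.
From mathcomp Require Import all_boot all_order all_algebra.
From mathcomp Require Import all_classical all_reals all_analysis.
From mathcomp Require Import spectral sesquilinear mxred complex ring lra.
Set Implicit Arguments. Unset Strict Implicit. Unset Printing Implicit Defensive.
Import Order.TTheory GRing.Theory Num.Theory.
Import numFieldNormedType.Exports.
Local Open Scope classical_set_scope.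
Local Open Scope ring_scope.

(* After a linear change of variables the second ellipsoid is the unit ball and
   the first one is its image under T.  Let S be the symmetric matrix with
   S^4 = T T^t, and let U be a maximal subset of the unit ball whose image under
   S is 1-separated.  Since U is a net for the ball in the metric |(u - v) S|,
   using it twice covers the image of the ball under S^2 by |U|^2 open unit
   balls, so every packing has at most |U|^2 points.  On the other hand the
   points u T, u in U, listed by increasing |u S|, are convexly separated: the
   vector u S^-2 T has norm |u| <= 1, its inner product with v T is
   <u S, v S>, and this exceeds at v = u every earlier value by at least 1/2. *)


(** * Diagonalization of real symmetric matrices *)

Lemma symmetric_diagonalizable (R : rcfType) (n : nat) (M : 'M[R]_n) :
  M^T = M ->
  exists (P : 'M[R]_n) (d : 'rV[R]_n), P \in unitmx /\ P *m M = diag_mx d *m P.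
Proof.
move=> symM; pose f := real_complex R; pose A := map_mx f M.
have realA : A \is a mxOver Num.real.
  by apply/mxOverP => i j; rewrite mxE; apply/complex_realP; eexists.
have symA : A \is hermitianmx n false idfun.
  by apply/is_hermitianmxP; rewrite expr0 scale1r map_mx_id// /A map_trmx symM.
have hermA := realsym_hermsym symA realA.
have /orthomx_spectralP AE := hermitian_normalmx hermA.
have reald := hermitian_spectral_diag_real hermA.
set D := spectral_diag A in AE reald.
have unitU := spectral_unit A.
(* The complex similarity between two real matrices descends to a real one; the base change is then
   known to be invertible, but no longer unitary. *)
have [] := @real_similar _ _ A (diag_mx D) _ realA _.
- exists (spectralmx A) => //; apply/(similarP unitU).
  by rewrite {2}AE !mulmxA mulmxV// mul1mx.
- by apply/mxOverP => i j; rewrite mxE rpredMn// (mxOverP reald).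
move=> Q /andP[/= realQ unitQ] /(similarP unitQ) QA.
pose P := map_mx (@complex.Re R) Q; pose d := map_mx (@complex.Re R) D.
have PE : map_mx f P = Q.
  by apply/matrixP => i j; rewrite !mxE /f RRe_real// (mxOverP realQ).
have dE : map_mx f d = D.
  by apply/matrixP => i j; rewrite !mxE /f RRe_real// (mxOverP reald).
exists P, d; split; first by rewrite -(map_unitmx f) PE.
by apply: (map_mx_inj (f := f)); rewrite !map_mxM map_diag_mx PE dE.
Qed.

(** * Euclidean inner product on row vectors *)

Definition dotr {R : pzRingType} {n : nat} (u v : 'rV[R]_n) : R := (u *m v^T) 0 0.

Definition sqnorm {R : pzRingType} {n : nat} (u : 'rV[R]_n) : R := dotr u u.

Section Dot.
Variables (R : realFieldType) (n : nat).
Implicit Types (u v w : 'rV[R]_n) (A B : 'M[R]_n).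

Lemma sqnormE u : sqnorm u = \sum_i u 0 i ^+ 2.
Proof. by rewrite /sqnorm /dotr mxE; apply: eq_bigr => i _; rewrite mxE expr2. Qed.

Lemma sqnorm_ge0 u : 0 <= sqnorm u.
Proof. by rewrite sqnormE sumr_ge0// => i _; rewrite sqr_ge0. Qed.

Lemma sqnorm_eq0 u : (sqnorm u == 0) = (u == 0).
Proof.
rewrite sqnormE psumr_eq0 => [|i _]; last exact: sqr_ge0.
apply/allP/eqP => [h|-> i _]; last by rewrite /= mxE expr0n eqxx.
by apply/rowP => i; rewrite mxE; apply/eqP; rewrite -sqrf_eq0; exact: (h i (mem_index_enum i)).
Qed.

Lemma dotrC u v : dotr u v = dotr v u.
Proof. by rewrite /dotr -[u *m v^T]trmxK trmx_mul trmxK mxE. Qed.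

Lemma dotrDl u v w : dotr (u + v) w = dotr u w + dotr v w.
Proof. by rewrite /dotr mulmxDl mxE. Qed.

Lemma dotrNl u w : dotr (- u) w = - dotr u w.
Proof. by rewrite /dotr mulNmx mxE. Qed.

Lemma dotrZl a u w : dotr (a *: u) w = a * dotr u w.
Proof. by rewrite /dotr -scalemxAl mxE. Qed.

Lemma dotrDr u v w : dotr w (u + v) = dotr w u + dotr w v.
Proof. by rewrite dotrC dotrDl !(dotrC w). Qed.

Lemma dotrNr u w : dotr w (- u) = - dotr w u.
Proof. by rewrite dotrC dotrNl (dotrC w). Qed.

Lemma dotrZr a u w : dotr w (a *: u) = a * dotr w u.
Proof. by rewrite dotrC dotrZl (dotrC w). Qed.

Lemma dotr_sumr m (F : 'I_m -> 'rV[R]_n) w :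
  dotr w (\sum_i F i) = \sum_i dotr w (F i).
Proof. by rewrite /dotr linear_sum mulmx_sumr summxE. Qed.

Lemma dotr_mulmxr u v A : dotr (u *m A) v = dotr u (v *m A^T).
Proof. by rewrite /dotr trmx_mul trmxK mulmxA. Qed.

Lemma sqnormB u v : sqnorm (u - v) = sqnorm u - 2 * dotr u v + sqnorm v.
Proof. by rewrite /sqnorm !dotrDl !dotrDr !dotrNl !dotrNr (dotrC v u); ring. Qed.

Lemma sqnormZ a u : sqnorm (a *: u) = a ^+ 2 * sqnorm u.
Proof. by rewrite /sqnorm dotrZl dotrZr mulrA expr2. Qed.

Lemma sqnormBC u v : sqnorm (u - v) = sqnorm (v - u).
Proof. by rewrite !sqnormB (dotrC v u); ring. Qed.

Lemma sqnormB_le u v : sqnorm (u - v) <= 2 * sqnorm u + 2 * sqnorm v.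
Proof.
have : 0 <= sqnorm (u - - v) by exact: sqnorm_ge0.
rewrite !sqnormB dotrNr /sqnorm dotrNl dotrNr => h; lra.
Qed.

Lemma dotr_le1 u v : sqnorm u <= 1 -> sqnorm v <= 1 -> dotr u v <= 1.
Proof.
have : 0 <= sqnorm (u - v) by exact: sqnorm_ge0.
rewrite sqnormB => h hu hv; lra.
Qed.

End Dot.

(** * Symmetric fourth root of a Gram matrix *)

Lemma diag_mx_commutant (R : idomainType) (n : nat) (K : 'M[R]_n) (d e : 'rV[R]_n) :
    (forall i j, d 0 i = d 0 j -> e 0 i = e 0 j) ->
  K *m diag_mx d = diag_mx d *m K -> K *m diag_mx e = diag_mx e *m K.
Proof.
move=> de Kd; apply/matrixP => i j; move/matrixP/(_ i j) : Kd.
rewrite !mul_mx_diag !mul_diag_mx !mxE => h.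
have [dij|dij] := eqVneq (d 0 i) (d 0 j); first by rewrite (de _ _ dij) mulrC.
suff -> : K i j = 0 by rewrite mul0r mulr0.
have /eqP : (d 0 i - d 0 j) * K i j = 0 by rewrite mulrBl -h mulrC subrr.
by rewrite mulf_eq0 subr_eq0 (negbTE dij) /= => /eqP.
Qed.

Lemma gram_fourth_root (R : rcfType) (n : nat) (T : 'M[R]_n) :
  exists S : 'M[R]_n, S^T = S /\ S *m S *m (S *m S) = T *m T^T.
Proof.
have symM : (T *m T^T)^T = T *m T^T by rewrite trmx_mul trmxK.
have [P [d [unitP PM]]] := symmetric_diagonalizable symM.
have d_ge0 i : 0 <= d 0 i.
  have PiM : row i P *m (T *m T^T) = d 0 i *: row i P.
    by apply/rowP => j; rewrite -row_mul PM mul_diag_mx !mxE.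
  (* For the eigenvector [p = row i P], [d 0 i * sqnorm p = sqnorm (p *m T)], and [p] is nonzero as
     a row of an invertible matrix. *)
  have := sqnorm_ge0 (row i P *m T).
  rewrite /sqnorm dotr_mulmxr -mulmxA PiM -/(dotr _ _) dotrZr -/(sqnorm _).
  rewrite pmulr_lge0// lt_def sqnorm_ge0 sqnorm_eq0 andbT.
  apply/eqP => /(congr1 (mulmx^~ (invmx P))) /eqP.
  rewrite -row_mul mulmxV// mul0mx row1 => /eqP/rowP/(_ i)/eqP.
  by rewrite !mxE !eqxx oner_eq0.
pose e : 'rV[R]_n := \row_i Num.sqrt (Num.sqrt (d 0 i)).
pose S := invmx P *m diag_mx e *m P.
have eE : diag_mx e *m diag_mx e *m (diag_mx e *m diag_mx e) = diag_mx d.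
  rewrite !mulmx_diag; congr diag_mx; apply/rowP => i; rewrite !mxE.
  by rewrite -!expr2 !sqr_sqrtr// sqrtr_ge0.
exists S; split; last first.
  rewrite -[RHS](mulKmx unitP) PM -eE /S.
  by rewrite !mulmxA !(mulmxK unitP).
(* S is symmetric because P *m P^T commutes with diag_mx d, hence with any function of d. *)
pose K := P *m P^T.
have Kd : K *m diag_mx d = diag_mx d *m K.
  rewrite /K mulmxA -PM -[in RHS]mulmxA -[in RHS]symM -trmx_mul PM.
  by rewrite trmx_mul tr_diag_mx mulmxA.
have Ke : K *m diag_mx e = diag_mx e *m K.
  by apply: diag_mx_commutant Kd => i j dij; rewrite !mxE dij.
rewrite /S !trmx_mul tr_diag_mx trmx_inv; apply: (can_inj (mulKmx unitP)).
apply: (can_inj (mulmxK (_ : P^T \in unitmx))); first by rewrite unitmx_tr.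
rewrite -!mulmxA mulVmx ?unitmx_tr// mulmx1 !mulmxA mulmxV// mul1mx.
by rewrite -[RHS]mulmxA; exact: Ke.
Qed.


(** * Separated lists in the ball and the packing bound *)

Section Separated.
Variables (R : realFieldType) (n : nat) (S : 'M[R]_n).
Implicit Types (u v : 'rV[R]_n) (s : seq 'rV[R]_n).

Definition apart : rel 'rV[R]_n := fun u v => 1 <= sqnorm ((u - v) *m S).

Definition ball_apart s : bool :=
  all (fun u => sqnorm u <= 1) s && pairwise apart s.

Lemma apartC : symmetric apart.
Proof. by move=> u v; rewrite /apart !mulmxBl sqnormBC. Qed.

Lemma maximal_apart_cover s :
    ball_apart s -> (forall s', ball_apart s' -> (size s' <= size s)%N) ->
  forall u, sqnorm u <= 1 ->
  exists2 v, v \in s & sqnorm ((u - v) *m S) < 1.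
Proof.
move=> /andP[ballS sepS] maxs u uB.
have : ~~ all (apart u) s.
  apply/negP => us; have := maxs (u :: s).
  by rewrite /ball_apart /= uB ballS us sepS ltnn => /(_ isT).
by case/allPn => v vs; rewrite /apart -ltNge; exists v.
Qed.

(** Each [x k] is coded by two net points: one approximates [x k], the other the remainder
    [(x k - v) *m S], again in the unit ball. Points sharing a code would have images under [S *m S]
    at squared distance below 2 + 2. *)
Lemma packing_le_apart N (x : 'I_N -> 'rV[R]_n) :
    (forall k, sqnorm (x k) <= 1) ->
    (forall k l, k != l -> 4 <= sqnorm ((x k - x l) *m (S *m S))) ->
  exists s, ball_apart s /\ (N <= size s * size s)%N.
Proof.
move=> xB xsep.
(* If the claim fails, a separated list has at most [N] points, since a longer one would prove it;
   hence a longest list exists. *)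
have [[s [ss Ns]]|small] :=
  pselect (exists s, ball_apart s /\ (N <= size s * size s)%N).
  by exists s.
pose has_size m := `[< exists2 s, ball_apart s & size s = m >].
have has0 : exists m, has_size m by exists 0%N; apply/asboolP; exists [::].
have hasN m : has_size m -> (m <= N)%N.
  move=> /asboolP[s ss <-]; rewrite leqNgt; apply/negP => Ns; apply: small.
  by exists s; split=> //; rewrite (leq_trans (ltnW Ns))// leq_pmulr// (leq_ltn_trans _ Ns).
case: (ex_maxnP has0 hasN) => m /asboolP[s ss sm] maxm.
exists s; split=> //.
have cover := maximal_apart_cover ss.
have {}cover u : sqnorm u <= 1 -> exists v, v \in s /\ sqnorm ((u - v) *m S) < 1.
  move=> uB; have [|v vs uv] := cover _ u uB; last by exists v.
  by move=> s' ss'; rewrite sm; apply: maxm; apply/asboolP; exists s'.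
have code k : exists p : 'rV[R]_n * 'rV[R]_n, [/\ p.1 \in s, p.2 \in s &
    sqnorm (((x k - p.1) *m S - p.2) *m S) < 1].
  have [v [vs xv]] := cover _ (xB k).
  by have [w [ws vw]] := cover _ (ltW xv); exists (v, w).
have [f fP] := choice code.
have finj : injective f.
  move=> k l fkl; apply/eqP; apply/negPn/negP => kl.
  have [_ _ hk] := fP k; have [_ _ hl] := fP l; rewrite -fkl in hl.
  have := sqnormB_le (((x k - (f k).1) *m S - (f k).2) *m S)
    (((x l - (f k).1) *m S - (f k).2) *m S).
  rewrite -mulmxBl opprB addrA subrK -mulmxBl opprB addrA subrK -mulmxA.
  have := xsep _ _ kl; lra.
rewrite -(size_allpairs (fun u v => (u, v))).
rewrite -[N]size_enum_ord -(size_map f).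
apply: uniq_leq_size; first by rewrite map_inj_uniq// enum_uniq.
move=> _ /mapP[k _ ->]; have [f1 f2 _] := fP k.
by apply/allpairsP; exists (f k); split=> //; case: (f k).
Qed.

Lemma apart_sort s : ball_apart s ->
  exists x : 'I_(size s) -> 'rV[R]_n, (forall i, sqnorm (x i) <= 1) /\
    forall i j : 'I_(size s), (i < j)%N ->
      sqnorm (x i *m S) <= sqnorm (x j *m S) /\ apart (x i) (x j).
Proof.
move=> /andP[ballS sepS].
pose r : rel 'rV[R]_n := relpre (fun u => sqnorm (u *m S)) <=%O.
have rT : total r by move=> u v; exact: le_total.
have rtr : transitive r by move=> u v w; exact: le_trans.
pose t := sort r s.
have st : size t = size s by rewrite size_sort.
exists (fun i => nth 0 t i); split.
  move=> i; have : nth 0 t i \in s by rewrite -(mem_sort r) mem_nth// st.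
  by move/(allP ballS).
move=> i j ij; split.
  have := sorted_ltn_nth rtr 0 (sort_sorted rT s).
  by apply; rewrite ?inE ?size_sort.
have nth_sep k l : (k < l < size s)%N -> apart (nth 0 s k) (nth 0 s l).
  by case/andP=> kl ls; apply: (pairwiseP 0 sepS) => //; rewrite inE// (ltn_trans kl).
(* A repeated point would be at distance 0 from itself. *)
have s_uniq : uniq s.
  apply/(uniqP 0) => k l; rewrite !inE => ks ls.
  wlog kl : k l ks ls / (k < l)%N.
    by move=> W; case: (ltngtP k l) => // kl e; [|apply/esym]; apply: W.
  move=> e; have := nth_sep k l; rewrite kl ls e => /(_ isT).
  by rewrite /apart subrr mul0mx sqnormE big1 ?ler10// => q _; rewrite mxE expr0n.
(* Separation by position becomes separation of distinct members, which survives sorting. *)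
have neq_sep u v : u \in s -> v \in s -> u != v -> apart u v.
  move=> us vs uv; rewrite -(nth_index 0 us) -(nth_index 0 vs).
  have : index u s != index v s by apply: contraNneq uv => e; rewrite -(nth_index 0 us) e nth_index.
  by case: ltngtP => // kl _; [|rewrite apartC]; apply: nth_sep; rewrite kl index_mem.
have ts k : (k < size s)%N -> nth 0 t k \in s.
  by move=> ks; rewrite -(mem_sort r) mem_nth// st.
apply: neq_sep; rewrite ?ts// nth_uniq ?st ?sort_uniq//.
by rewrite neq_ltn ij.
Qed.

End Separated.


(** * Functionals separating a point from its predecessors *)

Section Functional.
Variables (R : realFieldType) (n : nat) (S T : 'M[R]_n).
Hypotheses (symS : S^T = S) (S4 : S *m S *m (S *m S) = T *m T^T).
Hypothesis unitT : T \in unitmx.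
Implicit Types (u v : 'rV[R]_n).

(** Under the section hypotheses [invmx (S *m S) *m T] is the orthogonal factor in the polar
    decomposition of [T]. *)
Definition separating_functional u : 'rV[R]_n := u *m invmx (S *m S) *m T.

Lemma unit_sqS : S *m S \in unitmx.
Proof.
have : S *m S *m (S *m S) \in unitmx by rewrite S4 unitmx_mul unitmx_tr unitT.
by rewrite unitmx_mul andbb.
Qed.

Lemma sqnorm_mulmx_sqS u : sqnorm (u *m (S *m S)) = sqnorm (u *m T).
Proof.
rewrite /sqnorm !dotr_mulmxr -!mulmxA -S4 trmx_mul symS.
by rewrite !mulmxA.
Qed.

(** Moving [T] to the other side creates [T *m T^T], the fourth power of [S]; half of it cancels the
    inverse of [S *m S]. *)
Lemma separating_functionalE u v :
  dotr (separating_functional u) (v *m T) = dotr (u *m S) (v *m S).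
Proof.
rewrite /separating_functional dotr_mulmxr -mulmxA -S4 mulmxA.
have symQ : (S *m S)^T = S *m S by rewrite trmx_mul symS.
rewrite -{3}symQ -dotr_mulmxr mulmxKV ?unit_sqS//.
by rewrite [RHS]dotr_mulmxr symS mulmxA.
Qed.

Lemma sqnorm_separating_functional u : sqnorm (separating_functional u) = sqnorm u.
Proof.
by rewrite /separating_functional -sqnorm_mulmx_sqS mulmxKV// unit_sqS.
Qed.

(* By polarization the gap is half of |(v - u) S|^2 + |v S|^2 - |u S|^2. *)
Lemma separating_functional_gap u v :
    apart S u v -> sqnorm (u *m S) <= sqnorm (v *m S) ->
  dotr (separating_functional v) (u *m T) + 2^-1 <=
  dotr (separating_functional v) (v *m T).
Proof.
rewrite /apart mulmxBl sqnormB !separating_functionalE -/(sqnorm (v *m S)).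
rewrite (dotrC (v *m S)) => h1 h2; lra.
Qed.

End Functional.

(** * Packing and convex separation for ellipsoids *)

Section Ellipsoids.
Variables (R : realType) (n : nat).
Implicit Types (A : 'M[R]_n) (u v : 'rV[R]_n).

Lemma unit_ball2E u : unit_ball2 u = (sqnorm u <= 1) :> Prop.
Proof. by rewrite /unit_ball2 /= sqnormE. Qed.

Lemma open_sqnorm_lt A : open [set u : 'rV[R]_n | sqnorm (u *m A) < 1].
Proof.
apply: (@open_comp _ _ (fun u : 'rV[R]_n => sqnorm (u *m A)) [set x | x < 1]); last exact: open_lt.
move=> u _; rewrite (_ : (fun _ => _) =
    fun v : 'rV[R]_n => \sum_i (\sum_k v 0 k * A k i) ^+ 2); last first.
  by apply/funext => v; rewrite sqnormE; apply: eq_bigr => i _; rewrite mxE.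
apply: continuous_big => [|i _].
  by move=> p; exact: add_continuous.
move=> v; apply: (@continuous_comp _ _ _ (fun w : 'rV[R]_n => \sum_k w 0 k * A k i)
  (fun x : R => x ^+ 2)); last exact: exprn_continuous.
apply: continuous_big => [|k _].
  by move=> p; exact: add_continuous.
by move=> w; apply: continuousM; [exact: coord_continuous|exact: cst_continuous].
Qed.

Lemma interior_ellipsoid A v : A \in unitmx -> sqnorm (v *m invmx A) < 1 ->
  interior ((fun x => x *m A) @` @unit_ball2 R n) v.
Proof.
move=> unitA; have := @open_sqnorm_lt (invmx A).
move/open_subsetE => /(_ ((fun x => x *m A) @` @unit_ball2 R n)) e.
move: v; change ([set v : 'rV[R]_n | sqnorm (v *m invmx A) < 1] `<=`
  interior ((fun x => x *m A) @` @unit_ball2 R n)).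
rewrite -e => v /= vA; exists (v *m invmx A); last by rewrite mulmxKV.
by rewrite unit_ball2E ltW.
Qed.

(** If the bound 4 failed, the midpoint of the two centres would lie in both open translates. *)
Lemma packing_ellipsoid_dist (A B : 'M[R]_n) N :
    B \in unitmx ->
    packing_ok ((fun x => x *m A) @` @unit_ball2 R n)
      ((fun x => x *m B) @` @unit_ball2 R n) N ->
  exists x : 'I_N -> 'rV[R]_n, (forall k, sqnorm (x k) <= 1) /\
    forall k l, k != l -> 4 <= sqnorm ((x k - x l) *m (A *m invmx B)).
Proof.
move=> unitB [y [yA ydisj]].
have /choice[x xP] k : exists x, sqnorm x <= 1 /\ x *m A = y k.
  by have [x] := yA k; rewrite unit_ball2E; exists x.
exists x; split=> [k|k l kl]; first by have [] := xP k.
rewrite leNgt; apply/negP => lt4.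
(* The midpoint is both [y l + h] and [y k - h]. *)
pose h := 2^-1 *: (y k - y l).
have hlt : sqnorm (h *m invmx B) < 1.
  rewrite -scalemxAl sqnormZ -(xP k).2 -(xP l).2 -mulmxBl -mulmxA.
  by move: lt4; lra.
have : (translate_int (y k) ((fun x => x *m B) @` @unit_ball2 R n) `&`
        translate_int (y l) ((fun x => x *m B) @` @unit_ball2 R n)) (y l + h).
  split; last by exists h => //; exact: interior_ellipsoid.
  exists (- h); last first.
    rewrite -scalerN opprB; apply/rowP => i; rewrite !mxE.
    by field.
  by apply: interior_ellipsoid => //; rewrite mulNmx -scaleN1r sqnormZ sqrrN expr1n mul1r.
by rewrite (ydisj _ _ kl).
Qed.

(** With the points sorted by [sqnorm (x i *m S)], the functional of [x j] is at most [b - 2^-1] on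
    the hull of the earlier points and at least [b - 4^-1] on the translate at [x j]. *)
Lemma convsep_ellipsoid (A B S : 'M[R]_n) s (T := A *m invmx B) :
    A \in unitmx -> B \in unitmx -> S^T = S -> S *m S *m (S *m S) = T *m T^T ->
    ball_apart S s ->
  convsep_ok ((fun x => x *m A) @` @unit_ball2 R n)
    (scale_set 4^-1 ((fun x => x *m B) @` @unit_ball2 R n)) (size s).
Proof.
move=> unitA unitB symS S4 /apart_sort[x [xB xS]].
have unitT : T \in unitmx by rewrite unitmx_mul unitA unitmx_inv.
exists (fun i => x i *m A); split=> [i|j]; first by exists (x i); rewrite ?unit_ball2E.
rewrite -subset0 => _ [[_ /interior_subset [_ [z zB <-] <-] <-]] [l [l_ge0 [suml]]].
move/(congr1 (mulmx^~ (invmx B))).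
rewrite mulmxDl -scalemxAl mulmxK// -mulmxA -/T mulmx_suml.
set F := separating_functional S T (x j).
move/(congr1 (dotr F)); rewrite dotrDr dotrZr dotr_sumr.
set b := dotr F (x j *m T).
have gap : \sum_(i < j) dotr F (l i *: (x (widen_ord (ltnW (ltn_ord j)) i) *m A) *m invmx B)
    <= \sum_(i < j) l i * (b - 2^-1).
  apply: ler_sum => i _; rewrite -scalemxAl dotrZr ler_wpM2l// -mulmxA -/T.
  have [le_ij sep_ij] := xS (widen_ord (ltnW (ltn_ord j)) i) j (ltn_ord i).
  by have := separating_functional_gap symS S4 unitT sep_ij le_ij; rewrite -/F -/b; lra.
have Fz : - dotr F z <= 1.
  rewrite -dotrNr dotr_le1//; first by rewrite sqnorm_separating_functional.
  by rewrite -scaleN1r sqnormZ sqrrN expr1n mul1r -unit_ball2E.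
(* A common point would give [b - 4^-1 <= b - 2^-1]. *)
move=> e; move: gap; rewrite -e -mulr_suml suml; move: Fz; lra.
Qed.

End Ellipsoids.

(** * From counts to logarithms of suprema, and the conclusion *)

Lemma elog2_sup_le (R : realType) (P Q : nat -> Prop) :
    P 1 -> Q 0 ->
    (forall N, P N -> exists m, Q m /\ (N <= m * m)%N) ->
  (elog2 (ereal_sup [set (N%:R)%:E | N in P]) <=
   2%:E * elog2 (ereal_sup [set (N%:R)%:E | N in Q]) :> \bar R)%E.
Proof.
move=> P1 Q0 PQ.
have p1 : (1%:E <= ereal_sup [set (N%:R)%:E | N in P] :> \bar R)%E.
  by apply: ereal_sup_ubound; exists 1%N.
have q0 : (0%:E <= ereal_sup [set (N%:R)%:E | N in Q] :> \bar R)%E.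
  by apply: ereal_sup_ubound; exists 0%N.
have Qub m : Q m -> ((m%:R)%:E <= ereal_sup [set (N%:R)%:E | N in Q] :> \bar R)%E.
  by move=> Qm; apply: ereal_sup_ubound; exists m.
(* An infinite right side is trivial, and [Q 0] excludes [-oo]. *)
case: (ereal_sup [set (N%:R)%:E | N in Q]) q0 Qub => [r| |] q0 Qub /=; last 2 first.
- by rewrite mulry gtr0_sg// mul1e leey.
- by rewrite leeNy_eq in q0.
rewrite lee_fin in q0.
have pr : (ereal_sup [set (N%:R)%:E | N in P] <= (r ^+ 2)%:E :> \bar R)%E.
  apply: ge_ereal_sup => _ [N /PQ[m [/Qub + Nm]] <-]; rewrite lee_fin => mr.
  rewrite lee_fin (@le_trans _ _ ((m * m)%:R))// ?ler_nat//.
  by rewrite natrM -expr2 lerXn2r// nnegrE.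
case: (ereal_sup [set (N%:R)%:E | N in P]) p1 pr => [p| |] //=; rewrite ?lee_fin => p1 pr.
(* [P 1] gives [1 <= r ^+ 2], so the logarithm of [r] is a genuine one. *)
have r_gt0 : 0 < r.
  by rewrite lt_def q0 andbT; apply/eqP => r0; move: pr; rewrite r0 expr2 mul0r; lra.
rewrite /log2 mulrA ler_wpM2r ?invr_ge0 ?ln_ge0 ?ler1n//.
rewrite mulr_natl -lnXn// ler_ln ?posrE ?exprn_gt0//; lra.
Qed.

Theorem theorem2 (R : realType) :
  exists C c : R, 0 < C /\ 0 < c /\
    forall (n : nat) (E B : set 'rV[R]_n),
      is_ellipsoid E -> is_ellipsoid B ->
      (elog2 (packing_number E B) <= C%:E * elog2 (convsep_number E (scale_set c B)))%E.
Proof.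
(* The constant 2 is the exponent in [N <= size s * size s]; [4^-1] lies below the gap [2^-1] of the
   functionals. *)
exists 2, 4^-1; split; first by []; split; first by rewrite invr_gt0.
move=> n _ _ [A [unitA ->]] [B [unitB ->]].
apply: elog2_sup_le.
- exists (fun=> 0); split=> [_|i j]; last by rewrite (ord1 i) (ord1 j) eqxx.
  exists 0; last by rewrite mul0mx.
  by rewrite unit_ball2E sqnormE big1// => i _; rewrite mxE expr0n.
- by exists (fun=> 0); split=> -[].
move=> N /(packing_ellipsoid_dist unitB)[x [xB xdist]].
have [S [symS S4]] := gram_fourth_root (A *m invmx B).
have [|s [sS Ns]] := @packing_le_apart _ _ S _ _ xB.
  (* [S *m S] and [A *m invmx B] have the same Gram matrix, hence define the same distances. *)
  by move=> k l kl; rewrite (sqnorm_mulmx_sqS symS S4) xdist.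
by exists (size s); split=> //; exact: convsep_ellipsoid symS S4 sS.
Qed.
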